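(* Let $d\ge 2k\ge 2$ and let $M\in\mathcal{W}_k(d)$ be $2$-neighbourly. Then the mu-vector $(\mu_0,\dots,\mu_d)$ of $M$ (with respect to any field) is related to its $g$-vector $(g_0,\dots,g_{d+1})$ as follows: (a) $\mu_i=0$ for $k+1\le i\le d-k-1$; (b) $\displaystyle\sum_{i=1}^{l}(-1)^{l-i}\mu_i\ \le\ \frac{g_{l+1}}{\binom{d+2}{l+1}}$ for $1\le l\le k-1$; and (c) $\displaystyle\sum_{i=1}^{l}(-1)^{l-i}\mu_i\ =\ \frac{g_{l+1}}{\binom{d+2}{l+1}}$ for $k\le l\le d-k-1$.
   Context: All simplicial complexes are finite and abstract, with the empty set as a face. For a finite set $\alpha$, $\overline{\alpha}$ is the complex of all subsets of $\alpha$ and $\partial\alpha$ the complex of all proper subsets. The join $X\ast Y$ (disjoint vertex sets) has as faces the disjoint unions of a face of $X$ and a face of $Y$. The standard sphere $S^d_{d+2}$ is $\partial\alpha$ with $\#\alpha=d+2$. Complexes are identified up to isomorphism. Bistellar moves: if $X$ is $d$-dimensional and $\alpha,\beta$ are disjoint nonempty sets with $\dim\alpha+\dim\beta=d$ (where $\dim\alpha=\#\alpha-1$) such that the set of faces of $X$ contained in $\alpha\sqcup\beta$ is exactly $\overline{\alpha}\ast\partial\beta$, then $Y=(X\setminus(\overline\alpha\ast\partial\beta))\cup(\partial\alpha\ast\overline\beta)$ is obtained from $X$ by the bistellar move $\alpha\mapsto\beta$, of index $\dim\beta$ (if $\beta$ is a single vertex, it is a new vertex). For $0\le k\le d+1$,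 a $d$-dimensional complex is $k$-stellated if it is obtained from $S^d_{d+2}$ by a finite sequence of bistellar moves, each of index $<k$ ($S^d_{d+2}$ is the only $0$-stellated one). The link of a vertex $x$ in $X$ is $\mathrm{lk}_X(x)=\{\alpha\in X: x\notin\alpha,\ \alpha\sqcup\{x\}\in X\}$. For $0\le k\le d$, $\mathcal{W}_k(d)$ is the class of connected $d$-dimensional simplicial complexes all of whose vertex links are $k$-stellated $(d-1)$-spheres. $X$ is $2$-neighbourly if any two vertices form an edge. $f_i(X)$ is the number of $i$-dimensional faces ($f_{-1}=1$), and $g_j(X)=\sum_{i=-1}^{j-1}(-1)^{j-i-1}\binom{d-i+1}{j-i-1}f_i(X)$ for $0\le j\le d+1$, $d=\dim X$. Fix a field $\mathbb{F}$. Let $V(X)$ be the vertex set and $X[A]=\{\alpha\in X:\alpha\subseteq A\}$. $\beta_i(X)=\dim_{\mathbb{F}}H_i(X;\mathbb{F})$, $\widetilde\beta_i=\beta_i$ for $i\ne0$, $\widetilde\beta_0=\beta_0-1$ (so $\widetilde\beta_0(\emptyset)=-1$, $\widetilde\beta_i(\emptyset)=0$ for $i\ne0$, where $\emptyset$ is the complex whose only face is the empty set). For a complex $Z$ with $m$ vertices, $\sigma_i(Z)=\sum_{j=0}^{m}\binom{m}{j}^{-1}\sum_{A\subseteq V(Z),\,\#A=j}\widetilde\beta_i(Z[A])$. For $X$ of dimension $d$ with $m$ vertices, $\mu_0(X)=1$ and $\mu_i(X)=\delta_{i1}+\frac1m\sum_{x\in V(X)}\sigma_{i-1}(\mathrm{lk}_X(x))$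 for $1\le i\le d$ ($\delta$ the Kronecker delta). *)

(* Defs.v *)
From HB Require Import structures.
From mathcomp Require Import all_boot all_order all_algebra.
From mathcomp Require Import finmap.

Set Implicit Arguments.
Unset Strict Implicit.
Unset Printing Implicit Defensive.

Import Order.TTheory GRing.Theory Num.Theory.
Local Open Scope fset_scope.
Local Open Scope ring_scope.

(* Complexes matter only up to isomorphism, so all vertices are taken in nat:
   this leaves a fresh vertex available for every bistellar move, orders the
   vertices for the signs of the boundary maps, and makes [stellated] below
   invariant under isomorphism (any isomorphism between finite complexes
   extends to a permutation of nat). *)
Definition face : Type := {fset nat}.
Definition cplx : Type := {fset {fset nat}}.

Definition is_complex (X : cplx) : Prop :=
  fset0 \in X /\
  forall A B : {fset nat}, A \in X -> B `<=` A -> B \in X.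

Definition vertices (X : cplx) : {fset nat} := \bigcup_(A <- X) A.

(* Dimensions are integers: the empty face and the complex whose only face is
   empty have dimension -1. *)
Definition fdim (A : face) : int := #|` A|%:Z - 1.
Definition cdim (X : cplx) : int := (\max_(A <- X) #|` A|)%:Z - 1.

Definition full_simplex (A : face) : cplx := fpowerset A.
Definition simplex_bdry (A : face) : cplx := fpowerset A `\ A.

(* Only used for complexes on disjoint vertex sets. *)
Definition cjoin (X Y : cplx) : cplx :=
  [fset A `|` B | A in X, B in Y].

Definition induced (X : cplx) (A : face) : cplx :=
  [fset B in X | B `<=` A].

Definition lk (X : cplx) (x : nat) : cplx :=
  [fset A in X | (x \notin A) && (x |` A \in X)].

Definition bistellar_move (X : cplx) (A B : face) (Y : cplx) : Prop :=
  [/\ A != fset0 /\ B != fset0, [disjoint A & B]%fset,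
      fdim A + fdim B = cdim X,
      induced X (A `|` B) = cjoin (full_simplex A) (simplex_bdry B)
    & Y = (X `\` cjoin (full_simplex A) (simplex_bdry B))
            `|` cjoin (simplex_bdry A) (full_simplex B)].

Inductive stellated (k : nat) (d : int) : cplx -> Prop :=
| Stellated_std (A : face) :
    fdim A = d + 1 -> stellated k d (simplex_bdry A)
| Stellated_move (X Y : cplx) (A B : face) :
    stellated k d X -> bistellar_move X A B Y -> fdim B < k%:Z ->
    stellated k d Y.

Definition edge_rel (X : cplx) : rel nat := fun x y => [fset x; y] \in X.

Definition connected (X : cplx) : Prop :=
  forall x y : nat, x \in vertices X -> y \in vertices X ->
    exists2 p : seq nat, path (edge_rel X) x p & last x p = y.

Definition in_W (k d : nat) (X : cplx) : Prop :=
  [/\ (k <= d)%N, is_complex X, connected X, cdim X = d%:Z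
    & forall x : nat, x \in vertices X ->
        stellated k (d%:Z - 1) (lk X x)].

Definition two_neighbourly (X : cplx) : Prop :=
  forall x y : nat, x \in vertices X -> y \in vertices X -> x != y ->
    [fset x; y] \in X.

Definition nfaces (X : cplx) (i : int) : nat :=
  #|` [fset A in X | fdim A == i]|.

(* The summation index n is i + 1, where i runs from -1 to j - 1; the upper
   entry of the binomial is d - i + 1 = cdim X - n + 2, nonnegative in the range
   j <= cdim X + 1 where the g-vector is defined. *)
Definition g_vec (X : cplx) (j : nat) : int :=
  \sum_(0 <= n < j.+1)
     (-1) ^+ (j - n) *
     ('C(absz (cdim X - n%:Z + 2)%R, j - n) * nfaces X (n%:Z - 1)%R)%N%:Z.

Section Homology.
Variable F : fieldType.

(* A basis of the i-chains. *)
Definition faces_dim (X : cplx) (i : nat) : {fset {fset nat}} :=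
  [fset A in X | fdim A == i%:Z].

(* Coefficient of B in the boundary of A, for the increasing vertex order. *)
Definition incidence (A B : face) : F :=
  \sum_(v <- A | B == A `\ v) (-1) ^+ #|` [fset w in A | (w < v)%N]|.

(* Acts on row vectors.  For i = 0 both bases are the vertices and all entries
   vanish (no singleton is of the form A `\ v), so boundary X 0 is the zero map:
   the homology is not reduced. *)
Definition boundary (X : cplx) (i : nat) :
    'M[F]_(#|` faces_dim X i|, #|` faces_dim X i.-1|) :=
  \matrix_(a, b) incidence (nth fset0 (faces_dim X i) a)
                           (nth fset0 (faces_dim X i.-1) b).

(* Dimension of cycles modulo boundaries; the truncated subtraction is exact for
   a complex, since consecutive boundary maps compose to zero. *)
Definition betti (X : cplx) (i : nat) : nat :=
  (\rank (kermx (boundary X i)) - \rank (boundary X i.+1))%N.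

Definition rbetti (X : cplx) (i : nat) : int :=
  (betti X i)%:Z - (i == 0%N)%:Z.

Definition sigma (Z : cplx) (i : nat) : rat :=
  let m := #|` vertices Z| in
  \sum_(0 <= j < m.+1)
     ('C(m, j)%:R)^-1 *
     \sum_(A <- fpowerset (vertices Z) | #|` A| == j)
        (rbetti (induced Z A) i)%:~R.

Definition mu (X : cplx) (i : nat) : rat :=
  if i is i'.+1 then
    (i == 1%N)%:R +
    (#|` vertices X|%:R)^-1 *
      \sum_(x <- vertices X) sigma (lk X x) i'
  else 1.

End Homology.

(* Main.v *)
Require Import Defs.
From HB Require Import structures.
From mathcomp Require Import all_boot all_order all_algebra.
From mathcomp Require Import finmap zify ring.

Set Implicit Arguments.
Unset Strict Implicit.
Unset Printing Implicit Defensive.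

Import Order.TTheory GRing.Theory Num.Theory.
Local Open Scope fset_scope.
Local Open Scope ring_scope.

(** For a complex Z let e_l(Z) be the alternating sum of the numbers of faces of
    dimension < l (the empty face included) minus the rank of the l-th boundary
    map; for l > 0 it is the sum over i < l of (-1)^(l-1-i) times the i-th
    reduced Betti number of Z.  Only faces of dimension <= l matter, and on those
    a bistellar move a |-> b of index < k merely adds the faces B with
    b <= B <= a U b, since a is too big to be seen.  Passing from X[A] to Y[A] changes
    nothing if b is not inside A; if A meets a in some v, the new faces cancel in
    pairs B, B U {v}; if A misses a, the single face b appears and e_l changes by
    (-1)^(l-#b) when #b <= l, and does not increase otherwise.  The standard sphere is
    itself a move of this kind from the void complex, with b empty.  Hence e_l(L[A])
    for a k-stellated link L is bounded by a signed count of the moves with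
    b <= A and A disjoint from a, with equality for l >= k, and the number of moves with
    #b = s is g_s(L).

    Averaging over A uses the weights w(m,p) = 1/((m+1) C(m,p)), which satisfy
    w(m,p) = w(m+1,p) + w(m+1,p+1), so that the sum of w(#V,#A) over
    b <= A <= V \ a is w(#a+#b,#b).  Finally, summing the identity
    sum_x g_s(lk x) = (d+2-s) g_s(M) + (s+1) g_(s+1)(M) with these weights
    telescopes. *)

(** The terms at (x, y) and (y, x) cancel. The diagonal is a separate hypothesis because x = y in
    the second one gives only 2 f x x = 0, which is void in characteristic 2. *)
Lemma big_alternating (V : zmodType) (I : eqType) (s : seq I) (f : I -> I -> V) :
    (forall x, f x x = 0) ->
    (forall x y, x \in s -> y \in s -> f x y + f y x = 0) ->
  \sum_(x <- s) \sum_(y <- s) f x y = 0.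
Proof.
move=> f0; elim: s => [|a s IHs] fN; first by rewrite big_nil.
rewrite big_cons big_cons f0 add0r.
under [X in _ + X]eq_bigr do rewrite big_cons.
rewrite big_split /= IHs => [|x y xs ys]; last by rewrite fN // inE ?xs ?ys orbT.
rewrite addr0 -big_split /= big_seq big1 // => y ys.
by rewrite fN // inE ?eqxx // ys orbT.
Qed.

Lemma in_faces_dim (X : cplx) (A : face) i :
  (A \in faces_dim X i) = (A \in X) && (#|` A| == i.+1).
Proof. by rewrite !inE /= /fdim subr_eq -PoszD addn1. Qed.

Lemma card_facet (A : face) v : v \in A -> #|` A| = #|` A `\ v|.+1.
Proof. by move=> vA; rewrite (cardfsD1 v) vA. Qed.

(** * Boundary maps and their ranks *)

Section Boundary.
Variable F : fieldType.
Implicit Types (A B C : face) (X Y W : cplx).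

Definition bsign A (v : nat) : F := (-1) ^+ #|` [fset w in A | (w < v)%N]|.

Lemma bsign_rem_lt A u v : v \in A -> (v < u)%N -> bsign (A `\ v) u = - bsign A u.
Proof.
move=> vA ltvu; rewrite /bsign [in RHS](cardfsD1 v) !inE /= vA ltvu exprS mulN1r opprK.
by congr (_ ^+ #|` _|); apply/fsetP => w; rewrite !inE /= andbA.
Qed.

Lemma bsign_rem_gt A u v : (u < v)%N -> bsign (A `\ v) u = bsign A u.
Proof.
move=> ltuv; congr (_ ^+ #|` _|); apply/fsetP => w; rewrite !inE /=.
by case: (w =P v) => [->|//]; rewrite andFb ltnNge (ltnW ltuv) andbF.
Qed.

Lemma incidence_facet A v : v \in A -> incidence F A (A `\ v) = bsign A v.
Proof.
move=> vA; rewrite /incidence big_mkcond (big_fsetD1 _ vA) /= eqxx big1_seq ?addr0 // => w.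
rewrite !inE => /andP[_ /andP[nwv wA]]; case: eqP => // e.
have: w \in A `\ v by rewrite !inE nwv.
by rewrite e !inE eqxx.
Qed.

Lemma incidence_neq0 A B : incidence F A B != 0 -> exists2 v, v \in A & B = A `\ v.
Proof.
move=> nz; have [/hasP[v vA /eqP eB]|/hasPn nA] := boolP (has (fun v => B == A `\ v) A).
  by exists v.
case/eqP: nz; rewrite /incidence big1_seq // => v /andP[eB vA].
by have := nA v vA; rewrite eB.
Qed.

(** Two vertices can be removed in either order. Removing the smaller one first flips the sign of
    the larger, removing the larger first changes nothing, so the two contributions are opposite. *)
Lemma boundary_boundary A C :
  \sum_(v <- A) bsign A v * incidence F (A `\ v) C = 0.
Proof.
pose f v u : F := if (u != v) && (C == (A `\ v) `\ u)
                  then bsign A v * bsign (A `\ v) u else 0.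
transitivity (\sum_(v <- A) \sum_(u <- A) f v u).
  rewrite big_seq [RHS]big_seq; apply: eq_bigr => v vA.
  rewrite (big_fsetD1 _ vA) /= {1}/f eqxx add0r /incidence big_mkcond mulr_sumr.
  rewrite big_seq [RHS]big_seq; apply: eq_bigr => u.
  by rewrite !inE /f => /andP[-> _] /=; case: eqP; rewrite ?mulr0.
apply: big_alternating => [x|x y xA yA]; rewrite /f ?eqxx // eq_sym fsetDDl fsetUC -fsetDDl.
case: eqP => [->|/eqP nxy]; rewrite ?addr0 //=.
case: eqP => _; rewrite ?addr0 //.
have [ltxy|ltyx|exy] := ltngtP x y; last by rewrite exy eqxx in nxy.
- by rewrite bsign_rem_lt // bsign_rem_gt // mulrN mulrC addNr.
- by rewrite [X in _ + X]mulrC bsign_rem_gt // bsign_rem_lt // mulNr addrN.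
Qed.

Lemma boundary_mul0 X i :
    is_complex X -> boundary F X i.+1 *m boundary F X i = 0.
Proof.
case=> _ clX; apply/matrixP => a c; rewrite !mxE.
pose T := nth fset0 (faces_dim X i.+1) a; pose C := nth fset0 (faces_dim X i.-1) c.
have TX : T \in faces_dim X i.+1 by exact: mem_nth.
transitivity (\sum_(B <- faces_dim X i) incidence F T B * incidence F B C).
  by rewrite (big_nth fset0) big_mkord; apply: eq_bigr => b _; rewrite !mxE.
rewrite -[RHS](boundary_boundary T C).
under eq_bigr do rewrite /incidence big_mkcond mulr_suml.
rewrite exchange_big /= big_seq [RHS]big_seq; apply: eq_bigr => v vT.
have TvX : T `\ v \in faces_dim X i.
  move: TX; rewrite !in_faces_dim (card_facet vT) eqSS => /andP[TX ->].
  by rewrite (clX _ _ TX (fsubsetDl _ _)).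
rewrite (big_fsetD1 _ TvX) /= eqxx [X in _ + X]big1_seq ?addr0 // => B.
by rewrite !inE => /andP[_ /andP[/negbTE -> _]]; rewrite mul0r.
Qed.

(* All boundaries are expanded over one ambient list W of faces, so that the
   boundary ranks of different complexes can be compared. *)
Definition bd W A : 'rV[F]_#|` W| := \row_b incidence F A (nth fset0 W b).

Definition bspan W (s : seq face) : 'M[F]_#|` W| := (\sum_(A <- s) <<bd W A>>)%MS.

Lemma bd_colE W A C (CW : C \in W) :
  bd W A *m (\col_b (C == nth fset0 W b)%:R) = (incidence F A C)%:M :> 'M_1.
Proof.
apply/matrixP => i j; rewrite !ord1 !mxE /= mulr1n.
have ltC : (index C W < #|` W|)%N by rewrite index_mem.
rewrite (bigD1 (Ordinal ltC)) //= !mxE nth_index // eqxx mulr1 big1 ?addr0 // => b nb.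
rewrite !mxE; case: eqP => [eC|]; rewrite ?mulr0 //.
by case/eqP: nb; apply: val_inj; rewrite /= eC index_uniq ?fset_uniq ?ltn_ord.
Qed.

(** Extending row vectors by zero from the (i-1)-faces to all of [W] is injective, so it keeps the
    rank. The case i = 0 is excluded: [boundary] is zero there, while [bd] would record the empty
    face. *)
Lemma rank_boundary X W i :
    (0 < i)%N ->
    (forall A C, A \in X -> #|` A| = i.+1 -> C `<=` A -> C \in X) ->
    {subset faces_dim X i.-1 <= W} ->
  \rank (boundary F X i) = \rank (bspan W (faces_dim X i)).
Proof.
move=> i0 clX XW; set fi := faces_dim X i; set fj := faces_dim X i.-1.
(* [P] is the 0/1 matrix of this extension by zero; its transpose is a right inverse. *)
pose P : 'M[F]_(#|` fj|, #|` W|) := \matrix_(b, c) (nth fset0 fj b == nth fset0 W c)%:R.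
have Pfree : row_free P.
  apply/row_freeP; exists P^T; apply/matrixP => b b'; rewrite !mxE.
  have bW (x : 'I_#|` fj|) : nth fset0 fj x \in W by apply: XW; exact: mem_nth.
  have ltb : (index (nth fset0 fj b) W < #|` W|)%N by rewrite index_mem.
  rewrite (bigD1 (Ordinal ltb)) //= !mxE nth_index // eqxx mul1r big1 ?addr0.
    by rewrite nth_uniq ?fset_uniq // eq_sym.
  move=> c nc; rewrite !mxE; case: eqP => [eb|]; rewrite ?mul0r //.
  by case/eqP: nc; apply: val_inj; rewrite /= eb index_uniq ?fset_uniq ?ltn_ord.
rewrite -(mxrankMfree _ Pfree).
have -> : boundary F X i *m P = \matrix_a bd W (nth fset0 fi a).
  apply/row_matrixP => a; apply/rowP => c; rewrite !mxE.
  set A := nth fset0 fi a; set C := nth fset0 W c.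
  have : A \in fi by exact: mem_nth.
  rewrite in_faces_dim => /andP[AX /eqP eA].
  transitivity (\sum_(B <- fj) incidence F A B * (B == C)%:R).
    by rewrite (big_nth fset0) big_mkord; apply: eq_bigr => b _; rewrite !mxE.
  have [Cj|nCj] := boolP (C \in fj).
    rewrite (big_fsetD1 _ Cj) /= eqxx mulr1 big1_seq ?addr0 // => B.
    by rewrite !inE => /andP[_ /andP[/negbTE -> _]]; rewrite mulr0.
  rewrite big1_seq => [|B /= Bj]; last first.
    by case: eqP => [eB|_]; [by rewrite -eB Bj in nCj | rewrite mulr0].
  apply/esym/eqP; apply: contraNT nCj => /incidence_neq0[v vA ->].
  rewrite in_faces_dim (clX A _ AX eA (fsubsetDl _ _)) prednK //=.
  by move: eA; rewrite (card_facet vA) => -[->].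
apply/eqmx_rank/andP; split.
  apply/row_subP => a; rewrite rowK /bspan (big_rem (nth fset0 fi a)) /=; last exact: mem_nth.
  by apply: (submx_trans _ (addsmxSl _ _)); rewrite genmxE.
rewrite /bspan big_seq; elim/big_ind: _ => [|A B|A As]; first exact: sub0mx.
- by move=> sA sB; rewrite addsmx_sub sA.
- rewrite genmxE -(nth_index fset0 As); have ltA : (index A fi < #|` fi|)%N by rewrite index_mem.
  by apply: (eq_row_sub (Ordinal ltA)); rewrite rowK.
Qed.

Lemma bspan_sub W (s1 s2 : seq face) :
  {subset s1 <= s2} -> (bspan W s1 <= bspan W s2)%MS.
Proof.
move=> ss; rewrite /bspan big_seq; elim/big_ind: _ => [|A B|A As]; first exact: sub0mx.
  by move=> sA sB; rewrite addsmx_sub sA.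
by rewrite (big_rem A) ?ss //= addsmxSl.
Qed.

Lemma bspan_eq_rank W (s1 s2 : seq face) :
  s1 =i s2 -> \rank (bspan W s1) = \rank (bspan W s2).
Proof.
by move=> e; apply/eqP; rewrite eqn_leq !mxrankS ?bspan_sub // => x; rewrite e.
Qed.

Lemma bspan_dep W (s1 s2 : seq face) :
    (forall A, A \in s2 -> (bd W A <= bspan W s1)%MS) ->
  \rank (bspan W (s2 ++ s1)) = \rank (bspan W s1).
Proof.
elim: s2 => [//|A s2 IHs] dep; rewrite cat_cons /bspan big_cons -/(bspan _ _).
have /addsmx_idPr -> : (<<bd W A>> <= bspan W (s2 ++ s1))%MS.
  rewrite genmxE (submx_trans (dep A _)) ?mem_head //.
  by apply: bspan_sub => B Bs; rewrite mem_cat Bs orbT.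
by rewrite IHs // => B Bs; rewrite dep // inE Bs orbT.
Qed.

(** The coordinate at [C] is a linear functional that kills the span of [s] but not the boundary of
    [A]. *)
Lemma bspan_cons_free W A C (s : seq face) :
    C \in W -> incidence F A C != 0 -> (forall B, B \in s -> incidence F B C = 0) ->
  \rank (bspan W (A :: s)) = (\rank (bspan W s)).+1.
Proof.
move=> CW AC sC; rewrite /bspan big_cons -/(bspan W s).
have As : ~~ (bd W A <= bspan W s)%MS.
  apply: contra AC => As; pose c : 'cV[F]_#|` W| := \col_b (C == nth fset0 W b)%:R.
  have sc : (bspan W s <= kermx c)%MS.
    rewrite /bspan big_seq; elim/big_ind: _ => [|B D sB sD|B Bs]; first exact: sub0mx.
      by rewrite addsmx_sub sB.
    rewrite genmxE; apply/sub_kermxP; rewrite bd_colE // (sC B Bs).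
    exact: raddf0.
  have /sub_kermxP := submx_trans As sc.
  rewrite bd_colE // => /matrixP/(_ 0 0); rewrite !mxE mulr1n => ->.
  exact: eqxx.
apply/eqP; rewrite eqn_leq; apply/andP; split.
  rewrite (leq_trans (mxrank_adds_leqif _ _)) // mxrank_gen -[X in (_ <= X)%N]add1n.
  by rewrite leq_add2r rank_leq_row.
apply: rank_ltmx; rewrite ltmxE addsmxSr addsmx_sub genmxE submx_refl andbT.
by rewrite (negbTE As).
Qed.

(** Each face of [s2] owns a coordinate [C] on which all the others vanish, so each raises the rank
    by one. *)
Lemma bspan_free W (s1 s2 : seq face) :
    uniq s2 ->
    (forall A, A \in s2 -> exists C, [/\ C \in W, incidence F A C != 0 &
       forall B, B \in s2 ++ s1 -> B != A -> incidence F B C = 0]) ->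
    (forall A, A \in s2 -> A \notin s1) ->
  \rank (bspan W (s2 ++ s1)) = (size s2 + \rank (bspan W s1))%N.
Proof.
elim: s2 => [//|A s2 IHs] /= /andP[As2 us2] fr dis.
have [C [CW AC sC]] := fr A (mem_head _ _).
rewrite (bspan_cons_free CW AC) ?IHs // => [B Bs|B Bs|B Bs].
- have [|D [DW BD sD]] := fr B; first by rewrite inE Bs orbT.
  exists D; split=> // E Es.
  by apply: sD; rewrite inE Es orbT.
- by apply: dis; rewrite inE Bs orbT.
- apply: sC; first by rewrite inE Bs orbT.
  apply: contraTneq Bs => ->; rewrite mem_cat negb_or As2 /=; exact/dis/mem_head.
Qed.

End Boundary.

(** * Adding an interval of faces *)

Lemma in_fsep (X : cplx) (s : nat) (B : face) :
  (B \in [fset A in X | #|` A| == s]) = (B \in X) && (#|` B| == s).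
Proof. by rewrite !inE. Qed.

Definition fcount (X : cplx) (s : nat) : nat := #|` [fset A in X | #|` A| == s]|.

(** Only small faces are tracked, because the faces a move destroys are big. The void complex
    qualifies too, so that the standard sphere can be built from it. *)
Definition closed_upto (t : nat) (X : cplx) : Prop :=
  forall A B : face, A \in X -> (#|` A| <= t)%N -> B `<=` A -> B \in X.

Definition face_interval (a b : face) : cplx := [fset B in fpowerset (a `|` b) | b `<=` B].

Lemma in_face_interval a b B : (B \in face_interval a b) = (b `<=` B) && (B `<=` a `|` b).
Proof. by rewrite !inE /= fpowersetE andbC. Qed.

(* Y is obtained from X, as far as faces of size <= t are concerned, by a move
   a |-> b; the case X = fset0, b = fset0 gives the standard sphere. *)
Definition adds_interval (t : nat) (X Y : cplx) (a b : face) : Prop :=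
  [/\ [disjoint a & b]%fset,
      forall B : face, B `<=` a `|` b -> (B \in X) = ~~ (b `<=` B)
    & forall B : face, (#|` B| <= t)%N -> (B \in Y) = (B \in X) || (B \in face_interval a b)].

Section AddsInterval.
Variables (t : nat) (X Y : cplx) (a b : face).
Hypotheses (clX : closed_upto t X) (aXY : adds_interval t X Y a b).

Let dab : [disjoint a & b]%fset. Proof. by case: aXY. Qed.
Let Xab : forall B : face, B `<=` a `|` b -> (B \in X) = ~~ (b `<=` B).
Proof. by case: aXY. Qed.
Let Yt : forall B : face, (#|` B| <= t)%N -> (B \in Y) = (B \in X) || (B \in face_interval a b).
Proof. by case: aXY. Qed.

Lemma interval_notin B : B \in face_interval a b -> B \notin X.
Proof. by rewrite in_face_interval => /andP[bB Bab]; rewrite Xab // bB. Qed.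

(** A subset of an interval face lies in the interval if it contains [b], and otherwise already in
    [X]. *)
Lemma closed_upto_adds : closed_upto t Y.
Proof.
move=> A B + At BA; have Bt := leq_trans (fsubset_leq_card BA) At.
rewrite !Yt // => /orP[/clX-> //|]; rewrite !in_face_interval => /andP[bA Aab].
have Bab := fsubset_trans BA Aab; rewrite Xab // Bab andbT.
by case: (b `<=` B).
Qed.

Lemma fcount_adds s :
  (s <= t)%N -> fcount Y s = (fcount X s + fcount (face_interval a b) s)%N.
Proof.
move=> st; rewrite /fcount -cardfsUI [X in (_ + #|` X|)%N](_ : _ = fset0); last first.
  apply/fsetP => B; rewrite in_fsetI !in_fsep inE; apply/negP => /andP[/andP[BX _] /andP[BI _]].
  by have := interval_notin BI; rewrite BX.
rewrite cardfs0 addn0; congr #|` _|; apply/fsetP => B; rewrite in_fsetU !in_fsep.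
have [eB|] := eqVneq #|` B| s; rewrite ?andbF // !andbT.
by rewrite Yt ?eB.
Qed.

End AddsInterval.

Definition above (v : nat) (X : cplx) : cplx := [fset B in X | v \in B].

Lemma in_above v X B : (B \in above v X) = (B \in X) && (v \in B).
Proof. by rewrite !inE. Qed.

(** Sets of size s that avoid [v] correspond to those of size s + 1 that contain it, by adding [v];
    since [v] is in [a] this stays in the interval. *)
Lemma interval_pairing a b v s :
    v \in a -> v \notin b ->
  fcount (face_interval a b) s =
    (fcount (above v (face_interval a b)) s + fcount (above v (face_interval a b)) s.+1)%N.
Proof.
move=> va vb; rewrite /fcount -(cardfsID (above v (face_interval a b))); congr (_ + _)%N.
  congr #|` _|; apply/fsetP => B; rewrite in_fsetI !in_fsep in_above.
  by case: (B \in face_interval a b) (v \in B) => [] []; rewrite ?andbF ?andbT.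
set S := (X in #|` X| = _).
have SE B : (B \in S) = [&& B \in face_interval a b, v \notin B & #|` B| == s].
  rewrite in_fsetD !in_fsep in_above.
  by case: (B \in face_interval a b) (v \in B) => [] [].
rewrite -(card_in_imfset (f := fun B => v |` B) imfset_key (p := mem S)) /=; last first.
  move=> B C; rewrite !SE => /and3P[_ vB _] /and3P[_ vC _] e.
  by rewrite -[B](fsetU1K vB) e fsetU1K.
congr #|` _|; apply/fsetP => B; rewrite in_fsep in_above in_face_interval.
apply/imfsetP/idP => [[C /= + ->]|].
  rewrite SE in_face_interval cardfsU1 => /and3P[/andP[bC Cab] -> /eqP->].
  rewrite fset1U1 add1n eqxx !andbT fsubUset fsub1set Cab andbT.
  by rewrite inE va (fsubset_trans bC (fsubsetU1 _ _)).
move=> /andP[/andP[/andP[bB Bab] vB]]; rewrite (card_facet vB) eqSS => eB.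
exists (B `\ v); last by rewrite fsetD1K.
by rewrite SE eB in_face_interval fsubsetD1 bB vb (fsubset_trans (fsubsetDl _ _) Bab) !inE eqxx.
Qed.

(** * Change of the alternating sum [euler] when an interval is added *)

Section EulerStep.
Variable F : fieldType.

Definition euler (X : cplx) (l : nat) : int :=
  \sum_(0 <= s < l.+1) (-1) ^+ (l - s) * (fcount X s)%:Z - (\rank (boundary F X l))%:Z.

Variables (t : nat) (X Y : cplx) (a b : face) (l : nat).
Hypotheses (clX : closed_upto t X) (aXY : adds_interval t X Y a b).
Hypotheses (l_gt0 : (0 < l)%N) (ltlt : (l < t)%N).

Let W := X `|` Y.

Lemma rank_boundary_closed Z : closed_upto t Z -> Z `<=` W ->
  \rank (boundary F Z l) = \rank (bspan F W (faces_dim Z l)).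
Proof.
move=> clZ ZW; apply: rank_boundary => // [A C AZ eA CA|A].
  by apply: clZ CA => //; rewrite eA.
by rewrite in_faces_dim => /andP[AZ _]; apply: (fsubsetP ZW).
Qed.

Lemma faces_dim_adds (B : face) :
  (B \in faces_dim Y l) =
    (B \in face_interval a b) && (#|` B| == l.+1) || (B \in faces_dim X l).
Proof.
have [_ _ Yt] := aXY; rewrite !in_faces_dim.
have [eB|] := eqVneq #|` B| l.+1; rewrite ?andbF // !andbT Yt ?eB //.
by rewrite orbC.
Qed.

Lemma euler_split :
  euler Y l = euler X l
    + \sum_(0 <= s < l.+1) (-1) ^+ (l - s) * (fcount (face_interval a b) s)%:Z
    - ((\rank (boundary F Y l))%:Z - (\rank (boundary F X l))%:Z).
Proof.
rewrite /euler.
suff -> : \sum_(0 <= s < l.+1) (-1) ^+ (l - s) * (fcount Y s)%:Z =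
  \sum_(0 <= s < l.+1) (-1) ^+ (l - s) * (fcount X s)%:Z +
  \sum_(0 <= s < l.+1) (-1) ^+ (l - s) * (fcount (face_interval a b) s)%:Z by ring.
rewrite -big_split; apply: eq_big_nat => s /andP[_ sl].
by rewrite (fcount_adds aXY) ?PoszD ?mulrDr // -ltnS (leq_trans sl) // ltnW.
Qed.

Lemma fcount_interval0 s : fcount (face_interval fset0 b) s = (s == #|` b|).
Proof.
have -> : face_interval fset0 b = [fset b].
  by apply/fsetP => B; rewrite in_face_interval fset0U inE eqEfsubset andbC.
rewrite /fcount; case: eqP => [->|e].
  rewrite (_ : [fset _ in _ | _] = [fset b]) ?cardfs1 //.
  by apply/fsetP => B; rewrite in_fsep in_fset1; have [->|//] := eqVneq B b; rewrite eqxx.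
rewrite (_ : [fset _ in _ | _] = fset0) ?cardfs0 //.
apply/fsetP => B; rewrite in_fsep in_fset1 in_fset0; have [->|//] := eqVneq B b.
by apply/eqP => eb; case: e.
Qed.

Lemma rank_boundary_adds_ge : (\rank (boundary F X l) <= \rank (boundary F Y l))%N.
Proof.
rewrite !rank_boundary_closed ?fsubsetUl ?fsubsetUr //; last exact: closed_upto_adds aXY.
apply: mxrankS; apply: bspan_sub => B BX.
by rewrite faces_dim_adds BX orbT.
Qed.

(** The only new face [b] is too big to be counted, and the boundary rank, entering with a minus
    sign, can only grow (it may do so when [b] has size l + 1). *)
Lemma euler_adds_gt : a = fset0 -> (l < #|` b|)%N -> euler Y l <= euler X l.
Proof.
move=> a0 lb; rewrite euler_split a0.
rewrite big1_seq => [|s]; last first.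
  rewrite mem_index_iota fcount_interval0 => /andP[_ /andP[_ sl]].
  by rewrite ltn_eqF ?mulr0 // (leq_ltn_trans _ lb).
by have := rank_boundary_adds_ge; lia.
Qed.

(** The new face [b] is counted once, but its size is not l + 1, so the rank of the l-th boundary is
    unchanged. *)
Lemma euler_adds_le :
  a = fset0 -> (#|` b| <= l)%N -> euler Y l = euler X l + (-1) ^+ (l - #|` b|).
Proof.
move=> a0 bl; rewrite euler_split.
have -> : \rank (boundary F Y l) = \rank (boundary F X l).
  rewrite !rank_boundary_closed ?fsubsetUl ?fsubsetUr //; last exact: closed_upto_adds aXY.
  apply: bspan_eq_rank => B; rewrite faces_dim_adds a0 in_face_interval.
  rewrite fset0U -eqEfsubset; case: eqP => //= eb; case: eqP => //= eB.
  by move: bl; rewrite eb eB ltnn.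
rewrite subrr subr0 a0; congr (_ + _).
rewrite (bigD1_seq #|` b|) ?mem_index_iota ?iota_uniq //=.
rewrite fcount_interval0 eqxx mulr1 big1 ?addr0 // => s /negbTE sb.
by rewrite fcount_interval0 sb mulr0.
Qed.

(* For v in a, the boundary of v |` B expresses the boundary of a new face B
   avoiding v through the other faces, while each new face T containing v is
   independent of the rest because no other face has T `\ v as a facet. *)
Lemma euler_adds_neq0 : a != fset0 -> euler Y l = euler X l.
Proof.
case: aXY => dab Xab Yt /fset0Pn[v va]; have vb := fdisjointP dab v va.
rewrite euler_split.
pose N := above v (face_interval a b).
(* With [interval_pairing] the alternating sum telescopes; only the sets of size l + 1 containing
   [v] survive. *)
have -> : \sum_(0 <= s < l.+1) (-1) ^+ (l - s) * (fcount (face_interval a b) s)%:Z =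
          (fcount N l.+1)%:Z.
  have n0 : fcount N 0 = 0%N.
    apply/eqP; rewrite cardfs_eq0; apply/eqP/fsetP => B; rewrite in_fsep in_above inE.
    by case: eqP => [/cardfs0_eq ->|_]; rewrite ?in_fset0 !andbF.
  have H m : \sum_(0 <= s < m.+1) (-1) ^+ (m - s) * (fcount (face_interval a b) s)%:Z =
          (fcount N m.+1)%:Z.
    elim: m => [|m IHm].
      by rewrite big_nat1 subn0 mul1r (interval_pairing _ va vb) n0.
    rewrite big_nat_recr //= subnn mul1r (interval_pairing _ va vb) PoszD addrA.
    rewrite -[X in (_ + X) + _]IHm -big_split big_nat big1 ?add0r //= => s sm.
    by rewrite subSn ?exprS //; ring.
  exact: H.
have sXW : X `<=` W by exact: fsubsetUl.
have clY : closed_upto t Y by exact: closed_upto_adds aXY.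
rewrite !rank_boundary_closed ?fsubsetUr //.
pose N1 := [fset B in N | #|` B| == l.+1].
have NE B : B \in N1 = [&& b `<=` B, B `<=` a `|` b, v \in B & #|` B| == l.+1].
  by rewrite in_fsep in_above in_face_interval -!andbA.
have -> : \rank (bspan F W (faces_dim Y l)) = \rank (bspan F W (N1 ++ faces_dim X l)).
  rewrite -(bspan_dep (s1 := N1 ++ faces_dim X l)
    (s2 := [seq B <- face_interval a b | (#|` B| == l.+1) && (v \notin B)])).
    apply: bspan_eq_rank => B; rewrite faces_dim_adds !mem_cat !mem_filter NE.
    rewrite in_face_interval orbA; congr (_ || _).
    by case: (b `<=` B) (B `<=` _) (v \in B) (_ == _) => [] [] [] [].
  move=> B; rewrite mem_filter in_face_interval => /andP[/andP[/eqP eB vB] /andP[bB Bab]].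
  have vBab : v |` B `<=` a `|` b by rewrite fsubUset fsub1set inE va Bab.
  set T := v |` B; have vT : v \in T by exact: fset1U1.
  have eT : #|` T| = l.+2 by rewrite cardfsU1 vB eB.
  have bT : b `<=` T by exact: fsubset_trans bB (fsubsetU1 _ _).
  (* The boundary of the boundary of [T] vanishes. The facet opposite [v] is [B]; every other facet
     contains [v] and lies in [N1] or in [X]. *)
  have : \sum_(w <- T) bsign F T w *: bd F W (T `\ w) = 0.
    apply/rowP => c; rewrite summxE mxE -[RHS](boundary_boundary F T (nth fset0 W c)).
    by apply: eq_bigr => w _; rewrite !mxE.
  rewrite (big_fsetD1 _ vT) /= (fsetU1K vB) => /eqP; rewrite addr_eq0 => /eqP eTv.
  rewrite -(eqmx_scale (bd F W B) (a := bsign F T v)) ?signr_eq0 // eTv eqmx_opp.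
  rewrite big_seq; apply: summx_sub => w wB; apply: scalemx_sub.
  rewrite /bspan (big_rem (T `\ w)) /= ?(submx_trans _ (addsmxSl _ _)) ?genmxE //.
  have wT : w \in T by rewrite inE wB orbT.
  have eTw : #|` T `\ w| = l.+1 by move: eT; rewrite (card_facet wT) => -[].
  have Twab : T `\ w `<=` a `|` b by exact: fsubset_trans (fsubsetDl _ _) vBab.
  have vTw : v \in T `\ w.
    by rewrite !inE eqxx andbT; apply: contraNneq vB => ->.
  rewrite mem_cat NE in_faces_dim eTw eqxx vTw Twab andbT /= Xab // andbT.
  by case: (b `<=` _).
rewrite bspan_free ?fset_uniq //.
- by rewrite PoszD; set x := size _; rewrite (_ : fcount N l.+1 = x) //; ring.
- move=> A; rewrite NE => /and4P[bA Aab vA /eqP eA]; exists (A `\ v).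
  have bAv : b `<=` A `\ v by rewrite fsubsetD1 bA.
  have Avab : A `\ v `<=` a `|` b by exact: fsubset_trans (fsubsetDl _ _) Aab.
  split.
  + rewrite inE Yt ?in_face_interval ?bAv ?Avab ?orbT //.
    by move: eA; rewrite (card_facet vA) => -[->]; exact: ltnW.
  + by rewrite incidence_facet // signr_eq0.
  (* A face of [N1] with facet [A] minus [v] contains [v], hence equals [A]; a face of [X] would put
     that facet into [X], although it contains [b]. *)
  + move=> B; rewrite mem_cat => Bs nBA; apply/eqP; apply: contraNT nBA.
    case/incidence_neq0 => w wB eAB; case/orP: Bs => [|].
      rewrite NE => /and4P[_ _ vB _]; have vw : v = w.
        by apply/eqP; move/fsetP/(_ v): eAB; rewrite !inE eqxx vB andbT /=; case: eqP.
      by rewrite -(fsetD1K vB) vw -eAB -vw fsetD1K.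
    rewrite in_faces_dim => /andP[BX /eqP eB].
    have: A `\ v \in X by rewrite eAB; apply: clX BX _ (fsubsetDl _ _); rewrite eB.
    by rewrite Xab // bAv.
- move=> A; rewrite NE in_faces_dim => /and4P[bA Aab _ _].
  by rewrite Xab // bA.
Qed.

End EulerStep.

(** * Stellated complexes *)

(** The sets of the interval containing [v] form the interval from [b] with [v] added and [a] with
    [v] removed, so the pairing becomes Pascal's rule. *)
Lemma fcount_interval a b s :
    [disjoint a & b]%fset ->
  fcount (face_interval a b) s = (if (s < #|` b|)%N then 0 else 'C(#|` a|, s - #|` b|))%N.
Proof.
have [n] := ubnP #|` a|; elim: n a b s => // n IHn a b s; rewrite ltnS => an dab.
have [->|/fset0Pn[v va]] := eqVneq a fset0.
  rewrite fcount_interval0 cardfs0; case: ltngtP => [//|lt|->]; last by rewrite subnn.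
  by rewrite bin0n subn_eq0 leqNgt lt.
have vb := fdisjointP dab v va; rewrite (interval_pairing _ va vb).
have -> : above v (face_interval a b) = face_interval (a `\ v) (v |` b).
  apply/fsetP => B; rewrite in_above !in_face_interval fsetUA [_ `|` [fset v]]fsetUC fsetD1K //.
  by rewrite fsubUset fsub1set andbC andbA.
have dvab : [disjoint a `\ v & v |` b]%fset.
  apply/fdisjointP => w; rewrite !inE negb_or => /andP[-> wa] /=.
  exact: (fdisjointP dab).
have eb : #|` v |` b| = #|` b|.+1 by rewrite cardfsU1 vb.
have ea := card_facet va; have avn : (#|` a `\ v| < n)%N by rewrite -ea.
rewrite !IHn // eb {}ea !ltnS subSS.
case: (ltngtP s #|` b|) => [//|lt|->]; last by rewrite subnn !bin0.
by rewrite -(subnSK lt) binS addnC.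
Qed.

(** * Binomial sums and the g-numbers of an interval *)

Lemma sum_sign_bin (q : nat) :
  \sum_(0 <= i < q.+1) (-1) ^+ (q - i) * ('C(q, i))%:Z = (q == 0%N)%:Z.
Proof.
have := exprDn (-1 : int) 1 q; rewrite addNr expr0n => /esym e.
rewrite big_mkord -[RHS]natz -e; apply: eq_bigr => i _.
by rewrite expr1n mulr1 -mulr_natr natz.
Qed.

Lemma mul_bin_trans (n q i : nat) :
  (i <= q <= n)%N -> ('C(n, i) * 'C(n - i, q - i) = 'C(n, q) * 'C(q, i))%N.
Proof.
move=> /andP[iq qn].
have Hf : (0 < i`! * (q - i)`! * (n - q)`!)%N by rewrite !muln_gt0 !fact_gt0.
apply/eqP; rewrite -(eqn_pmul2r Hf); apply/eqP.
have e1 := bin_fact (leq_trans iq qn); have e2 := bin_fact qn; have e3 := bin_fact iq.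
have e4 := bin_fact (leq_sub2r i qn).
rewrite (_ : (n - i - (q - i) = n - q)%N) in e4; last by lia.
transitivity n`!.
  by rewrite -e1 -e4; ring.
by rewrite -e2 -e3; ring.
Qed.

(* The g-number g_j of a complex of dimension D - 2. *)
Definition gcount (D : nat) (X : cplx) (j : nat) : int :=
  \sum_(0 <= n < j.+1) (-1) ^+ (j - n) * ('C(D - n, j - n) * fcount X n)%N%:Z.

(** After the shift by #b the product of binomials factors through [mul_bin_trans], and what remains
    is the expansion of (1 - 1)^(j - #b). Thus a move raises only the g-number of index #b. *)
Lemma gcount_interval a b j :
    [disjoint a & b]%fset -> (j <= #|` a|)%N ->
  gcount (#|` a| + #|` b|) (face_interval a b) j = (j == #|` b|)%:Z.
Proof.
move=> dab ja; rewrite /gcount; set p := #|` a|; set r := #|` b|.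
have [jr|rj] := ltnP j r.
  rewrite big_nat big1 ?ltn_eqF // => n; rewrite ltnS => nj.
  by rewrite fcount_interval // (leq_ltn_trans nj jr) muln0 mulr0.
rewrite (big_cat_nat (n := r)) //=; last exact: ltnW.
rewrite big_nat big1 ?add0r => [|n /andP[_ nr]]; last first.
  by rewrite fcount_interval // nr muln0 mulr0.
rewrite -[X in \sum_(X <= i < _) _]add0n big_addn.
rewrite (_ : (j.+1 - r = (j - r).+1)%N); last by lia.
transitivity ('C(p, j - r)%:Z * \sum_(0 <= i < (j - r).+1) (-1) ^+ (j - r - i) * ('C(j - r, i))%:Z).
  rewrite mulr_sumr; apply: eq_big_nat => i; rewrite ltnS => /andP[_ ij].
  rewrite fcount_interval // ltnNge leq_addl /= addnK.
  rewrite (_ : (j - (i + r) = j - r - i)%N); last by lia.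
  rewrite (_ : (p + r - (i + r) = p - i)%N); last by lia.
  rewrite mulnC mul_bin_trans ?PoszM; last by rewrite ij (leq_trans (leq_subr _ _) ja).
  by rewrite mulrCA.
rewrite sum_sign_bin subn_eq0; case: (ltngtP j r) rj => // [lt|->] _; first by rewrite mulr0.
by rewrite subnn bin0.
Qed.

Lemma gcount_adds t X Y a b D j :
    adds_interval t X Y a b -> (j <= t)%N ->
  gcount D Y j = gcount D X j + gcount D (face_interval a b) j.
Proof.
move=> aXY jt; rewrite /gcount -big_split; apply: eq_big_nat => n; rewrite ltnS => /andP[_ nj].
by rewrite (fcount_adds aXY) ?(leq_trans nj) // mulnDr PoszD mulrDr.
Qed.

(** * Restriction to vertex subsets and histories of moves *)

Lemma in_induced X A B : (B \in induced X A) = (B \in X) && (B `<=` A).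
Proof. by rewrite !inE. Qed.

Lemma closed_upto_induced t X A : closed_upto t X -> closed_upto t (induced X A).
Proof.
move=> clX B C; rewrite !in_induced => /andP[BX BA] Bt CB.
by rewrite (clX _ _ BX Bt CB) (fsubset_trans CB BA).
Qed.

(** Restriction shrinks [a] and keeps [b]; this is why [adds_interval] does not prescribe the sizes
    of [a] and [b]. *)
Lemma adds_interval_induced t X Y a b A :
    adds_interval t X Y a b -> b `<=` A ->
  adds_interval t (induced X A) (induced Y A) (a `&` A) b.
Proof.
move=> [dab Xab Yt] bA; split=> [|B Bab|B Bt].
- by apply/fdisjointP => v; rewrite inE => /andP[va _]; exact: (fdisjointP dab).
- have BA : B `<=` A.
    by apply: fsubset_trans Bab _; rewrite fsubUset fsubsetIr.
  rewrite in_induced BA andbT Xab //; apply: fsubset_trans Bab _.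
  by rewrite fsetSU // fsubsetIl.
- rewrite !in_induced !in_face_interval Yt // in_face_interval andb_orl -andbA.
  congr (_ || (_ && _)).
  apply/andP/idP => [[Bab BA]|Bab]; last first.
    split; apply: fsubset_trans Bab _; first by rewrite fsetSU // fsubsetIl.
    by rewrite fsubUset fsubsetIr.
  apply/fsubsetP => v vB; have := fsubsetP Bab v vB; rewrite !inE.
  by rewrite (fsubsetP BA v vB) andbT.
Qed.

(** The sets [A] on which the restricted move adds the lone face [b]. *)
Definition hits (A : face) (p : face * face) : bool :=
  (p.2 `<=` A) && [disjoint p.1 & A]%fset.

Section History.
Variables (F : fieldType) (d k : nat).
Hypotheses (k_gt0 : (0 < k)%N) (k2d : (2 * k <= d)%N).

Lemma euler_ext t X Y l :
    (0 < l < t)%N -> closed_upto t X ->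
    (forall B : face, (#|` B| <= t)%N -> (B \in Y) = (B \in X)) ->
  euler F Y l = euler F X l.
Proof.
move=> /andP[l0 lt] clX YX; rewrite /euler; congr (_ - _%:Z).
  apply: eq_big_nat => s; rewrite ltnS => /andP[_ sl]; congr (_ * Posz #|` _|).
  apply/fsetP => B; rewrite !in_fsep; case: eqP => eB; rewrite ?andbF // YX //.
  by rewrite eB (leq_trans sl) // ltnW.
have fYX : faces_dim Y l = faces_dim X l.
  by apply/fsetP => B; rewrite !in_faces_dim; case: eqP => eB; rewrite ?andbF // YX ?eB.
have clY : closed_upto t Y.
  move=> A B AY At BA; rewrite YX; last exact: leq_trans (fsubset_leq_card BA) At.
  by apply: clX BA => //; rewrite -YX.
rewrite (rank_boundary_closed F (X := X) (Y := Y) l0 lt clX) ?fsubsetUl //.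
by rewrite (rank_boundary_closed F (X := X) (Y := Y) l0 lt clY) ?fsubsetUr // fYX.
Qed.

(** If [b] is not inside [A] nothing small is added, and if [A] meets [a] the new faces cancel.
    Strict inequality can occur only when [A] is hit and #b > l. *)
Lemma euler_induced_adds t X Y a b A l :
    (0 < l < t)%N -> closed_upto t X -> adds_interval t X Y a b ->
  let e := if (#|` b| <= l)%N && hits A (a, b) then (-1) ^+ (l - #|` b|) else 0 in
  euler F (induced Y A) l <= euler F (induced X A) l + e /\
  ((#|` b| <= l)%N -> euler F (induced Y A) l = euler F (induced X A) l + e).
Proof.
move=> lt clX aXY; have [_ _ Yt] := aXY; have /andP[l0 ltt] := lt; rewrite /hits /=.
have clXA : closed_upto t (induced X A) by exact: closed_upto_induced.
have [bA|nbA] := boolP (b `<=` A); last first.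
  rewrite andbF addr0 (euler_ext lt clXA) // => B Bt; rewrite !in_induced Yt //.
  rewrite in_face_interval; have [BA|] := boolP (B `<=` A); rewrite ?andbF // !andbT.
  have [bB|] := boolP (b `<=` B); rewrite ?orbF //.
  by rewrite (fsubset_trans bB BA) in nbA.
have aXYA := adds_interval_induced aXY bA.
rewrite /= -fsetI_eq0; have [aA|aA] := eqVneq (a `&` A) fset0; last first.
  by rewrite andbF addr0 (euler_adds_neq0 F clXA aXYA l0 ltt aA).
rewrite andbT; have [bl|lb] := leqP #|` b| l.
  by rewrite (euler_adds_le F clXA aXYA l0 ltt aA bl).
by rewrite addr0; split=> //; exact: (euler_adds_gt F clXA aXYA l0 ltt aA lb).
Qed.

(* [s] lists the moves (a, b) that build X from the void complex. *)
Definition history (X : cplx) (s : seq (face * face)) : Prop :=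
  [/\ closed_upto (d - k) X,
      forall p, p \in s ->
        [/\ [disjoint p.1 & p.2]%fset, (#|` p.1| + #|` p.2| = d.+1)%N, (#|` p.2| <= k)%N
          & forall v, v \in p.1 `|` p.2 -> [fset v] \in X],
      forall j, (j <= d - k)%N ->
        gcount d.+1 X j = (count (fun p : face * face => #|` p.2| == j) s)%:Z,
      forall A l, (0 < l < d - k)%N ->
        euler F (induced X A) l <=
          \sum_(p <- s | (#|` p.2| <= l)%N && hits A p) (-1) ^+ (l - #|` p.2|)
    & forall A l, (0 < l < d - k)%N -> (k <= l)%N ->
        euler F (induced X A) l =
          \sum_(p <- s | (#|` p.2| <= l)%N && hits A p) (-1) ^+ (l - #|` p.2|)].

Lemma history_void : history fset0 [::].
Proof.
have e0 A l : (0 < l < d - k)%N -> euler F (induced fset0 A) l = 0.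
  move=> /andP[l0 lt]; have cl : closed_upto (d - k) (induced fset0 A).
    by move=> B C; rewrite in_induced inE.
  rewrite /euler (rank_boundary_closed F (X := induced fset0 A)
    (Y := induced fset0 A) l0 lt) ?fsubsetUl //.
  have -> : faces_dim (induced fset0 A) l = fset0.
    by apply/fsetP => B; rewrite in_faces_dim in_induced !in_fset0.
  rewrite /bspan big_seq_fset0 mxrank0 subr0 big1 // => s _.
  rewrite (_ : fcount _ s = 0%N) ?mulr0 //; apply/eqP; rewrite cardfs_eq0.
  by apply/eqP/fsetP => B; rewrite in_fsep in_induced !in_fset0.
split=> [B C|p|j _|A l lt|A l lt _]; rewrite ?inE //.
- rewrite /gcount big1 // => n _.
  rewrite (_ : fcount _ n = 0%N) ?muln0 ?mulr0 //; apply/eqP; rewrite cardfs_eq0.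
  by apply/eqP/fsetP => B; rewrite in_fsep !in_fset0.
- by rewrite big_nil e0.
- by rewrite big_nil e0.
Qed.

Lemma history_adds X Y a b s :
    adds_interval (d - k) X Y a b -> (#|` a| + #|` b| = d.+1)%N -> (#|` b| <= k)%N ->
  history X s -> history Y ((a, b) :: s).
Proof.
move=> aXY eab bk [clX sX gX eX eX']; have [dab Xab Yt] := aXY.
have clY := closed_upto_adds clX aXY.
have t_gt0 : (0 < d - k)%N by lia.
split=> [//|p|j jt||].
- have XY v : [fset v] \in X -> [fset v] \in Y by move=> vX; rewrite Yt ?cardfs1 // vX.
  rewrite inE => /orP[/eqP -> /=|/sX[dp ep pk pX]]; last first.
    by split=> // v /pX; exact: XY.
  split=> // v vab; have v1 : [fset v] `<=` a `|` b by rewrite fsub1set.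
  (* A singleton containing [b] (so [b] is empty or a new vertex) is in the interval; any other lies
     in [X]. *)
  by rewrite Yt ?cardfs1 // in_face_interval v1 Xab // andbT; case: (b `<=` _).
(* [gcount_interval] applies because #a = d + 1 - #b is at least d + 1 - k, hence exceeds j. *)
- rewrite (gcount_adds _ aXY jt) gX // /= -eab gcount_interval //; last by lia.
  by rewrite PoszD addrC eq_sym.
- move=> A l lt; have [le _] := euler_induced_adds A lt clX aXY.
  apply: (le_trans le); rewrite big_cons /= addrC.
  by case: ifP => _; rewrite ?add0r ?lerD2l eX.
- move=> A l lt kl; have [_ e] := euler_induced_adds A lt clX aXY.
  have bl := leq_trans bk kl; rewrite e // big_cons eX' //= addrC.
  by case: ifP => _; rewrite ?add0r.
Qed.

Lemma cdim_eq X e :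
    (forall A : face, A \in X -> (#|` A| <= e)%N) ->
    (exists2 A : face, A \in X & #|` A| = e) ->
  cdim X = e%:Z - 1.
Proof.
move=> Xe [A AX eA]; congr (Posz _ - _); apply/eqP; rewrite eqn_leq; apply/andP; split.
  by apply/bigmax_leqP_seq => B BX _; exact: Xe.
by rewrite -eA (big_rem A) //= leq_maxl.
Qed.

Lemma in_cjoin_bdry a b B :
    [disjoint a & b]%fset ->
  (B \in cjoin (full_simplex a) (simplex_bdry b)) = (B `<=` a `|` b) && ~~ (b `<=` B).
Proof.
move=> dab; apply/imfset2P/andP => [[C /= Ca [D /= Db ->]]|[Bab nbB]].
  move: Ca Db; rewrite !inE /= !fpowersetE => Ca /andP[nDb Db]; split.
    by rewrite fsetUSS.
  apply: contra nDb => /fsubsetP bCD; rewrite eqEfsubset Db; apply/fsubsetP => v vb.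
  have := bCD v vb; rewrite inE => /orP[/(fsubsetP Ca) va|//].
  by have := fdisjointP dab v va; rewrite vb.
exists (B `&` a); first by rewrite /= fpowersetE fsubsetIr.
exists (B `&` b).
  rewrite /= !inE /= fpowersetE fsubsetIr andbT; apply: contra nbB => /eqP {1}<-.
  exact: fsubsetIl.
by rewrite -fsetIUr; apply/esym/fsetIidPl.
Qed.

Lemma cjoinC X Y : cjoin X Y = cjoin Y X.
Proof.
have sub U V : cjoin U V `<=` cjoin V U.
  apply/fsubsetP => B /imfset2P[C CU [D DV ->]]; apply/imfset2P.
  exists D; first exact: DV.
  exists C; first exact: CU.
  exact: fsetUC.
by apply/eqP; rewrite eqEfsubset !sub.
Qed.

Lemma stellated_history X :
    stellated k (d%:Z - 1) X ->
  exists s, history X s.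
Proof.
(* The dimension is carried through the induction, since a bistellar move fixes #a + #b only through
   [cdim X]. *)
move=> stX; suff [Xd Xd' hs] :
    [/\ (forall A : face, A \in X -> (#|` A| <= d)%N),
     (exists2 A : face, A \in X & #|` A| = d) & exists s, history X s].
  exact: hs.
elim: stX => {X} [a ea|X Y a b stX [Xd Xd' [s hs]] [[a0 b0] dab eab indX eY] bk].
  have {}ea : #|` a| = d.+1 by move: ea; rewrite /fdim; lia.
  have in_bdry B : (B \in simplex_bdry a) = (B != a) && (B `<=` a).
    by rewrite !inE /= fpowersetE.
  split.
  - move=> B; rewrite in_bdry => /andP[nBa Ba].
    rewrite -ltnS -ea ltn_neqAle fsubset_leq_card // andbT.
    by apply: contra nBa => /eqP e; rewrite eqEfcard Ba e leqnn.
  - have /fset0Pn[v va] : a != fset0 by rewrite -cardfs_gt0 ea.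
    exists (a `\ v); last by move: ea; rewrite (card_facet va) => -[].
    rewrite in_bdry fsubsetDl andbT; apply: contraTneq va => <-.
    by rewrite !inE eqxx.
  (* The boundary of [a] arises from the void complex by adding all subsets of [a]; the excess face
     [a] has size d + 1, above the cut-off d - k. *)
  - exists [:: (a, fset0)]; apply: (history_adds (X := fset0)); last exact: history_void.
    + split=> [|B _|B Bt]; first exact: fdisjointX0.
        by rewrite inE fsub0set.
      rewrite in_bdry in_face_interval fsub0set fsetU0 inE /=.
      by case: eqP => // eB; move: Bt; rewrite eB ea; lia.
    + by rewrite cardfs0 addn0.
    + by rewrite cardfs0.
have {}eab : (#|` a| + #|` b| = d.+1)%N.
  by move: eab; rewrite (cdim_eq Xd Xd') /fdim; lia.
have {}bk : (#|` b| <= k)%N by move: bk; rewrite /fdim; lia.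
have YE B : (B \in Y) = ((B `<=` a `|` b) && ~~ (a `<=` B)) ||
     (B \in X) && ~~ ((B `<=` a `|` b) && ~~ (b `<=` B)).
  rewrite eY in_fsetU in_fsetD [cjoin (simplex_bdry a) _]cjoinC in_cjoin_bdry //.
  rewrite in_cjoin_bdry 1?fdisjoint_sym //.
  by rewrite orbC [b `|` a]fsetUC [(B \in X) && _]andbC.
have cab : #|` a `|` b| = d.+1.
  by rewrite cardfsU (eqP (_ : a `&` b == fset0)) ?cardfs0 ?subn0 // fsetI_eq0.
split.
- move=> B; rewrite YE => /orP[/andP[Bab naB]|/andP[/Xd//]].
  rewrite -ltnS -cab ltn_neqAle fsubset_leq_card // andbT.
  apply: contra naB => /eqP e; have /eqP -> : B == a `|` b by rewrite eqEfcard Bab e leqnn.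
  exact: fsubsetUl.
- have /fset0Pn[v va] := a0; have vab : v \in a `|` b by rewrite inE va.
  exists ((a `|` b) `\ v); last by move: cab; rewrite (card_facet vab) => -[].
  rewrite YE fsubsetDl /= (_ : a `<=` _ = false) //.
  by apply/negP => /fsubsetP/(_ v va); rewrite !inE eqxx.
- exists ((a, b) :: s); apply: history_adds hs => //.
  have Xab B : B `<=` a `|` b -> (B \in X) = ~~ (b `<=` B).
    by move=> Bab; have := in_cjoin_bdry B dab; rewrite -indX in_induced Bab andbT.
  split=> // B Bt; rewrite YE in_face_interval.
  have [Bab|] := boolP (B `<=` a `|` b); rewrite ?andbF ?orbF ?andbT //=.
  (* The faces lost by the move contain [a], so they have size at least d + 1 - k, above the
     cut-off. *)
  rewrite Xab //; have [aB|_] := boolP (a `<=` B).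
    by have := leq_trans (fsubset_leq_card aB) Bt; lia.
  by case: (b `<=` B).
Qed.

End History.

(** * Betti numbers and averaging over vertex sets *)

Section Betti.
Variables (F : fieldType) (Z : cplx).
Hypothesis clZ : is_complex Z.

Lemma card_faces_dim (X : cplx) i : #|` faces_dim X i| = fcount X i.+1.
Proof.
by congr #|` _|; apply/fsetP => B; rewrite in_faces_dim in_fsep.
Qed.

Lemma boundary0 (X : cplx) : boundary F X 0 = 0.
Proof.
apply/matrixP => a b; rewrite !mxE; apply/eqP; apply: contraT => /incidence_neq0[v vA eB].
have := mem_nth fset0 (ltn_ord a); have := mem_nth fset0 (ltn_ord b).
rewrite eB !in_faces_dim => /andP[_ /eqP eAv] /andP[_].
by rewrite (card_facet vA) eAv.
Qed.

Lemma bettiE i :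
  (betti F Z i)%:Z =
    (fcount Z i.+1)%:Z - (\rank (boundary F Z i))%:Z - (\rank (boundary F Z i.+1))%:Z.
Proof.
rewrite /betti -card_faces_dim -subzn.
  by rewrite mxrank_ker -subzn // rank_leq_row.
by apply: mxrankS; apply/sub_kermxP; exact: boundary_mul0.
Qed.

Lemma fcount0 : fcount Z 0 = 1%N.
Proof.
have [Z0 _] := clZ; rewrite /fcount (_ : [fset _ in _ | _] = [fset fset0]) ?cardfs1 //.
apply/fsetP => B; rewrite in_fsep in_fset1 cardfs_eq0.
by have [->|] := eqVneq B fset0; rewrite ?Z0 ?andbF.
Qed.

(** The counts of sizes up to l cancel, leaving the number of l-faces minus two consecutive boundary
    ranks. *)
Lemma eulerS l : euler F Z l.+1 + euler F Z l = (betti F Z l)%:Z.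
Proof.
rewrite bettiE /euler big_nat_recr //= subnn mul1r.
rewrite (_ : \sum_(0 <= s < l.+1) (-1) ^+ (l.+1 - s) * (fcount Z s)%:Z =
             - \sum_(0 <= s < l.+1) (-1) ^+ (l - s) * (fcount Z s)%:Z).
  by ring.
rewrite -sumrN; apply: eq_big_nat => s; rewrite ltnS => /andP[_ sl].
by rewrite subSn // exprS mulN1r mulNr.
Qed.

Lemma euler_rbetti l :
  euler F Z l.+1 = \sum_(0 <= i < l.+1) (-1) ^+ (l - i) * rbetti F Z i.
Proof.
elim: l => [|l IHl].
  (* [euler] at 0 counts just the empty face; this 1 is the one subtracted in the reduced Betti
     number of degree 0. *)
  rewrite big_nat1 subnn mul1r /rbetti -eulerS [X in _ = _ + X - _]/euler big_nat1.
  by rewrite boundary0 mxrank0 subr0 mul1r fcount0 addrK.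
rewrite big_nat_recr //= subnn mul1r {2}/rbetti subr0 -eulerS.
have -> : \sum_(0 <= i < l.+1) (-1) ^+ (l.+1 - i) * rbetti F Z i = - euler F Z l.+1.
  rewrite IHl -sumrN; apply: eq_big_nat => i; rewrite ltnS => /andP[_ il].
  by rewrite subSn // exprS mulN1r mulNr.
by ring.
Qed.

End Betti.

Lemma is_complex_induced X A : is_complex X -> is_complex (induced X A).
Proof.
move=> [X0 clX]; split=> [|B C]; first by rewrite in_induced X0 fsub0set.
rewrite !in_induced => /andP[BX BA] CB.
by rewrite (clX _ _ BX CB) (fsubset_trans CB BA).
Qed.

Lemma in_lk X x A : (A \in lk X x) = [&& A \in X, x \notin A & x |` A \in X].
Proof. by rewrite !inE. Qed.

Lemma verticesP X v : reflect (exists2 A : face, A \in X & v \in A) (v \in vertices X).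
Proof.
rewrite /vertices; apply: (iffP idP) => [/bigfcupP[A /andP[AX _] vA]|[A AX vA]].
  by exists A.
by apply/bigfcupP; exists A; rewrite ?AX.
Qed.

Lemma vertex_face X v : is_complex X -> (v \in vertices X) = ([fset v] \in X).
Proof.
move=> [_ clX]; apply/verticesP/idP => [[A AX vA]|vX].
  by apply: clX AX _; rewrite fsub1set.
by exists [fset v]; rewrite ?inE.
Qed.

Lemma is_complex_lk X x : is_complex X -> x \in vertices X -> is_complex (lk X x).
Proof.
move=> cX; rewrite vertex_face // => xX; have [X0 clX] := cX.
split=> [|A B]; first by rewrite in_lk X0 inE fsetU0.
rewrite !in_lk => /and3P[AX xA xAX] BA; apply/and3P; split.
- exact: clX AX BA.
- by apply: contra xA; exact: fsubsetP.
- by apply: clX xAX _; exact: fsetUS.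
Qed.

Lemma vertices_lk X x :
    is_complex X -> two_neighbourly X -> x \in vertices X ->
  vertices (lk X x) = vertices X `\ x.
Proof.
move=> cX nX xX; apply/fsetP => v; rewrite vertex_face; last exact: is_complex_lk.
rewrite in_lk -vertex_face // !inE eq_sym; apply/and3P/andP => [[]//|[nxv vX]].
by split=> //; apply: nX; rewrite // eq_sym.
Qed.

(** For p <= m this is the Beta integral of x^p (1 - x)^(m - p) over [0, 1]. *)
Definition weight (m p : nat) : rat := ((m.+1 * 'C(m, p))%N%:R)^-1.

(** In the integral this is 1 = (1 - x) + x. *)
Lemma weight_split m p : (p <= m)%N -> weight m p = weight m.+1 p + weight m.+1 p.+1.
Proof.
move=> pm; rewrite /weight.
have C0 : ('C(m, p)%:R != 0 :> rat) by rewrite pnatr_eq0 -lt0n bin_gt0.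
have e1 : (m.+1%:R - p%:R) * 'C(m.+1, p)%:R = m.+1%:R * 'C(m, p)%:R :> rat.
  by rewrite -natrB ?leqW // -!natrM mul_bin_down.
have e2 : p.+1%:R * 'C(m.+1, p.+1)%:R = m.+1%:R * 'C(m, p)%:R :> rat.
  by rewrite -!natrM -mul_bin_diag.
have m1 : (m.+1%:R != 0 :> rat) by rewrite pnatr_eq0.
have m2 : (m.+2%:R != 0 :> rat) by rewrite pnatr_eq0.
have mp : m.+1%:R - p%:R != 0 :> rat by rewrite -natrB ?leqW // pnatr_eq0 subSn.
have eD : ('C(m.+1, p)%:R)^-1 = (m.+1%:R - p%:R) / (m.+1%:R * 'C(m, p)%:R) :> rat.
  by rewrite -e1 invfM mulrA mulfV ?mul1r.
have eE : ('C(m.+1, p.+1)%:R)^-1 = p.+1%:R / (m.+1%:R * 'C(m, p)%:R) :> rat.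
  by rewrite -e2 invfM mulrA mulfV ?mul1r ?pnatr_eq0.
rewrite !natrM !invfM eD eE; field.
by rewrite C0 -[1 + _](natrD _ 1 m) -(natrD _ 2 m) m1.
Qed.

(** Pick x uniformly in [0, 1] and each vertex with probability x: both sides are the probability of
    containing [b] and avoiding [a]. The proof adds each remaining vertex to [a] or to [b],
    according to whether [A] omits or contains it. *)
Lemma sum_weight (V a b : face) :
    [disjoint a & b]%fset -> a `|` b `<=` V ->
  \sum_(A <- fpowerset V | hits A (a, b)) weight #|` V| #|` A| =
  weight (#|` a| + #|` b|) #|` b|.
Proof.
have [n] := ubnP #|` V `\` (a `|` b)|; elim: n a b => // n IHn a b; rewrite ltnS => Vn dab abV.
have [/eqP|/fset0Pn[v]] := eqVneq (V `\` (a `|` b)) fset0.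
  rewrite fsetD_eq0 => Vab; have {Vab abV} eV : V = a `|` b.
    by apply/eqP; rewrite eqEfsubset Vab.
  have bV : b \in fpowerset V by rewrite fpowersetE eV fsubsetUr.
  rewrite big_mkcond (big_fsetD1 _ bV) /= /hits /= fsubset_refl dab /=.
  rewrite big1_seq ?addr0 => [|A].
    by rewrite eV cardfsU (eqP (_ : a `&` b == fset0)) ?cardfs0 ?subn0 // fsetI_eq0.
  rewrite !inE /= fpowersetE eV => /andP[nAb Aab]; case: andP => // -[bA daA].
  case/eqP: nAb; apply/eqP; rewrite eqEfsubset bA andbT; apply/fsubsetP => w wA.
  have := fsubsetP Aab w wA; rewrite inE => /orP[wa|//].
  by have := fdisjointP daA w wa; rewrite wA.
rewrite inE => /andP[]; rewrite inE negb_or => /andP[va vb] vV.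
have card_lt U : U = V `\` (a `|` b) `\ v -> (#|` U| < n)%N.
  move=> ->; apply: leq_trans Vn; rewrite [X in (_ < X)%N](cardfsD1 v).
  by rewrite !inE negb_or va vb vV add1n.
rewrite (bigID (fun A : face => v \notin A)) /=.
rewrite weight_split; last exact: leq_addl.
congr (_ + _).
- rewrite -addSn (_ : (#|` a|.+1 = #|` v |` a|)%N); last by rewrite cardfsU1 va.
  rewrite -IHn.
  + apply: eq_bigl => A; rewrite /hits /= fdisjointU1X.
    by case: (b `<=` A); rewrite //= andbC.
  + by apply: card_lt; rewrite -fsetUA fsetDDl fsetUC.
  + by rewrite fdisjointU1X vb.
  + by rewrite -fsetUA fsubUset fsub1set vV.
- rewrite -addnS (_ : (#|` b|.+1 = #|` v |` b|)%N); last by rewrite cardfsU1 vb.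
  rewrite -IHn.
  + apply: eq_bigl => A; rewrite /hits /= negbK fsubUset fsub1set.
    by rewrite andbC andbA.
  + by apply: card_lt; rewrite fsetUCA fsetDDl fsetUC.
  + by rewrite fdisjoint_sym fdisjointU1X va fdisjoint_sym.
  + by rewrite fsetUCA fsubUset fsub1set vV.
Qed.

Lemma sigmaE (F : fieldType) (Z : cplx) i :
  sigma F Z i = \sum_(A <- fpowerset (vertices Z))
     ('C(#|` vertices Z|, #|` A|)%:R)^-1 * (rbetti F (induced Z A) i)%:~R.
Proof.
rewrite /sigma; set V := vertices Z.
under eq_bigr do rewrite mulr_sumr big_mkcond.
rewrite exchange_big /= big_seq [RHS]big_seq; apply: eq_bigr => A.
rewrite fpowersetE => AV; rewrite (bigD1_seq #|` A|) ?iota_uniq //=; last first.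
  by rewrite mem_index_iota ltnS fsubset_leq_card.
by rewrite eqxx big1 ?addr0 // => j /negbTE; rewrite eq_sym => ->.
Qed.

Lemma sum_sigma (F : fieldType) (Z : cplx) l : is_complex Z ->
  \sum_(0 <= i < l.+1) (-1) ^+ (l - i) * sigma F Z i =
  \sum_(A <- fpowerset (vertices Z))
     ('C(#|` vertices Z|, #|` A|)%:R)^-1 * (euler F (induced Z A) l.+1)%:~R.
Proof.
move=> cZ; under eq_bigr do rewrite sigmaE mulr_sumr.
rewrite exchange_big /=; apply: eq_bigr => A _.
rewrite euler_rbetti; last exact: is_complex_induced.
rewrite rmorph_sum mulr_sumr; apply: eq_bigr => i _.
by rewrite rmorphM rmorphXn rmorphN1 mulrCA.
Qed.

(** * Sigma-numbers of stellated links *)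

Section StellatedLink.
Variables (F : fieldType) (d k : nat) (L : cplx) (s : seq (face * face)).
Hypotheses (k_gt0 : (0 < k)%N) (k2d : (2 * k <= d)%N).
Hypotheses (cL : is_complex L) (hL : history F d k L s).

Let V := vertices L.

Lemma move_sum l : (l < d - k)%N ->
  \sum_(A <- fpowerset V) ('C(#|` V|, #|` A|)%:R)^-1 *
     (\sum_(p <- s | (#|` p.2| <= l)%N && hits A p) (-1) ^+ (l - #|` p.2|))%:~R =
  #|` V|.+1%:R * \sum_(0 <= j < l.+1) (-1) ^+ (l - j) * (gcount d.+1 L j)%:~R * weight d.+1 j.
Proof.
move=> lt; have [clL sL gL _ _] := hL.
(* The inverse binomial is #V + 1 times [weight]. Summing over [A] first, [sum_weight] turns each
   move into a weight depending only on #b, as #a + #b = d + 1. *)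
transitivity (\sum_(p <- s | (#|` p.2| <= l)%N)
    (#|` V|.+1%:R * ((-1) ^+ (l - #|` p.2|) * weight d.+1 #|` p.2|))).
  transitivity (\sum_(A <- fpowerset V) \sum_(p <- s | (#|` p.2| <= l)%N)
     if hits A p then ('C(#|` V|, #|` A|)%:R)^-1 * (-1) ^+ (l - #|` p.2|) else 0 : rat).
    apply: eq_bigr => A _; rewrite rmorph_sum mulr_sumr -big_mkcondr.
    by apply: eq_bigr => p _; rewrite rmorphXn rmorphN1.
  rewrite exchange_big /= big_seq_cond [RHS]big_seq_cond.
  apply: eq_bigr => p /andP[/sL[dp ep pk pL] pl]; rewrite -big_mkcond /= -mulr_suml.
  rewrite -ep -(sum_weight (V := V) dp); last first.
    by apply/fsubsetP => v /pL; rewrite -vertex_face.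
  rewrite -surjective_pairing mulrCA [LHS]mulrC !mulr_sumr; apply: eq_bigr => A _.
  by rewrite /weight natrM invfM mulVKf // pnatr_eq0.
rewrite -mulr_sumr; congr (_ * _).
(* Group the moves by j = #b; [history] says that their number is the j-th g-number. *)
transitivity (\sum_(p <- s) \sum_(0 <= j < l.+1)
   if #|` p.2| == j then (-1) ^+ (l - j) * weight d.+1 j else 0).
  rewrite big_mkcond; apply: eq_bigr => p _; case: leqP => pl.
    rewrite (bigD1_seq #|` p.2|) ?iota_uniq ?mem_index_iota ?ltnS //= eqxx.
    by rewrite big1 ?addr0 // => j /negbTE; rewrite eq_sym => ->.
  rewrite big_nat big1 // => j; rewrite ltnS => /andP[_ jl].
  by rewrite gtn_eqF // (leq_ltn_trans jl).
rewrite exchange_big /=; apply: eq_big_nat => j; rewrite ltnS => /andP[_ jl].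
rewrite gL; last by rewrite ltnW // (leq_ltn_trans jl).
rewrite -big_mkcond /= big_const_seq iter_addr_0 -mulr_natr.
by rewrite pmulrn mulrAC.
Qed.

Lemma sum_sigma_le l : (l.+1 < d - k)%N ->
  \sum_(0 <= i < l.+1) (-1) ^+ (l - i) * sigma F L i <=
  #|` V|.+1%:R *
    \sum_(0 <= j < l.+2) (-1) ^+ (l.+1 - j) * (gcount d.+1 L j)%:~R * weight d.+1 j.
Proof.
move=> lt; have [_ _ _ eL _] := hL; rewrite sum_sigma // -move_sum //.
apply: ler_sum => A _; apply: ler_wpM2l; first by rewrite invr_ge0.
by rewrite ler_int eL.
Qed.

Lemma sum_sigma_eq l : (k <= l.+1 < d - k)%N ->
  \sum_(0 <= i < l.+1) (-1) ^+ (l - i) * sigma F L i =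
  #|` V|.+1%:R *
    \sum_(0 <= j < l.+2) (-1) ^+ (l.+1 - j) * (gcount d.+1 L j)%:~R * weight d.+1 j.
Proof.
move=> /andP[kl lt]; have [_ _ _ _ eL] := hL; rewrite sum_sigma // -move_sum //.
by apply: eq_bigr => A _; rewrite eL.
Qed.

(** Every move has #b <= k <= i, so [euler] at i and at i + 1 is the same signed count with opposite
    signs. Their sum, the i-th Betti number, vanishes for every induced complex. *)
Lemma sigma_eq0 i : (k <= i)%N -> (i.+1 < d - k)%N -> sigma F L i = 0.
Proof.
move=> ki it; have [_ sL _ _ eL] := hL.
have i0 : (0 < i)%N by exact: leq_trans ki.
rewrite sigmaE big1 // => A _; rewrite /rbetti gtn_eqF // subr0.
rewrite -eulerS; last exact: is_complex_induced.
rewrite !eL ?i0 ?it ?ki ?(leqW ki) ?(ltnW it) //.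
suff -> : \sum_(p <- s | (#|` p.2| <= i.+1)%N && hits A p) (-1) ^+ (i.+1 - #|` p.2|) =
    - \sum_(p <- s | (#|` p.2| <= i)%N && hits A p) (-1) ^+ (i - #|` p.2|) :> int.
  by rewrite addNr mulr0.
rewrite -sumrN big_seq_cond [RHS]big_seq_cond; apply: eq_big => p.
  have [/sL[_ _ pk _]|//] := boolP (p \in s).
  by rewrite (leq_trans pk ki) (leq_trans pk (leqW ki)).
by move=> /andP[/sL[_ _ pk _] _]; rewrite subSn ?(leq_trans pk ki) // exprS mulN1r.
Qed.

End StellatedLink.

(** * Links of vertices *)

Lemma fcount_lk X x n : is_complex X ->
  fcount (lk X x) n = (\sum_(B <- [fset A in X | #|` A| == n.+1%N]) (x \in B))%N.
Proof.
move=> [X0 clX]; set S := [fset A in X | _].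
transitivity #|` above x S|.
  rewrite /fcount -(card_in_imfset (f := fun B => x |` B) imfset_key
     (p := mem [fset A in lk X x | #|` A| == n])) /=; last first.
    move=> B C; rewrite !in_fsep !in_lk.
    move=> /andP[/and3P[_ xB _] _] /andP[/and3P[_ xC _] _] e.
    by rewrite -[B](fsetU1K xB) e fsetU1K.
  congr #|` _|; apply/fsetP => B; rewrite in_above in_fsep.
  apply/imfsetP/idP => [[C /= + ->]|/andP[/andP[BX eB] xB]].
    rewrite in_fsep in_lk cardfsU1 => /andP[/and3P[_ -> ->] /eqP ->].
    by rewrite fset1U1 add1n eqxx.
  exists (B `\ x); last by rewrite fsetD1K.
  rewrite /= in_fsep in_lk (clX _ _ BX (fsubsetDl _ _)) fsetD1K // BX !inE eqxx /=.
  by move: eB; rewrite (card_facet xB) eqSS.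
rewrite card_fset_sum1 /above -big_fset_condE big_mkcond.
by apply: eq_bigr => B _; case: (x \in B).
Qed.

Lemma sum_fcount_lk X n : is_complex X ->
  (\sum_(x <- vertices X) fcount (lk X x) n = n.+1 * fcount X n.+1)%N.
Proof.
move=> cX; under eq_bigr do rewrite fcount_lk //.
rewrite exchange_big /=.
transitivity (\sum_(B <- [fset A in X | #|` A| == n.+1]) n.+1)%N; last first.
  by rewrite big_const_seq count_predT iter_addn_0.
rewrite big_seq [RHS]big_seq; apply: eq_bigr => B; rewrite in_fsep => /andP[BX /eqP <-].
transitivity (\sum_(x <- B) (x \in B))%N.
  apply/esym/big_fset_incl => [|x _ /negbTE -> //].
  by apply/fsubsetP => x xB; apply/verticesP; exists B.
by rewrite card_fset_sum1 big_seq [RHS]big_seq; apply: eq_bigr => x ->.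
Qed.

(** Double counting yields a factor n, written as (j + 1) - (j + 1 - n). The first part gives the
    term in j + 1; in the second, (j + 1 - n) C(D + 1 - n, j + 1 - n) = (D + 1 - j) C(D + 1 - n, j -
    n). *)
Lemma sum_gcount_lk (D : nat) X j : is_complex X -> (j <= D)%N ->
  \sum_(x <- vertices X) gcount D (lk X x) j =
    (D.+1 - j)%N%:Z * gcount D.+1 X j + j.+1%:Z * gcount D.+1 X j.+1.
Proof.
move=> cX jD; rewrite /gcount exchange_big /=.
transitivity (\sum_(0 <= n < j.+2)
   (-1) ^+ (j.+1 - n) * ('C(D.+1 - n, j.+1 - n) * (n * fcount X n))%N%:Z).
  rewrite [RHS]big_nat_recl // mul0n muln0 mulr0 add0r; apply: eq_bigr => n _.
  rewrite -mulr_sumr !subSS -sum_fcount_lk //; congr (_ * _).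
  by rewrite big_distrr /= -!natz natr_sum; apply: eq_bigr => x _; rewrite natz.
rewrite [X in _ + _ * X]big_nat_recr //= [LHS]big_nat_recr //= !subnn !mul1r !bin0 !mul1n.
rewrite mulrDr addrA PoszM; congr (_ + _); rewrite !mulr_sumr -big_split.
apply: eq_big_nat => n; rewrite ltnS => /andP[_ nj] /=; rewrite subSn // exprS mulN1r.
have e := mul_bin_left (D.+1 - n) (j - n).
rewrite (_ : (D.+1 - n - (j - n) = D.+1 - j)%N) in e; last by lia.
have {}e : (j.+1%:Z - n%:Z) * ('C(D.+1 - n, (j - n).+1))%:Z =
           (D.+1 - j)%N%:Z * ('C(D.+1 - n, j - n))%:Z.
  by rewrite -!PoszM -e PoszM; congr (_ * _); lia.
rewrite !PoszM.
transitivity (j.+1%:Z * (- (-1) ^+ (j - n) * ('C(D.+1 - n, (j - n).+1)%:Z * (fcount X n)%:Z))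
  + (-1) ^+ (j - n) * (fcount X n)%:Z * ((j.+1%:Z - n%:Z) * ('C(D.+1 - n, (j - n).+1))%:Z)).
  by ring.
by rewrite e; ring.
Qed.

Lemma g_vecE X d j : cdim X = d%:Z -> (j <= d.+2)%N -> g_vec X j = gcount d.+2 X j.
Proof.
move=> dX jd; rewrite /g_vec /gcount dX; apply: eq_big_nat => n; rewrite ltnS => /andP[_ nj].
rewrite (_ : absz _ = (d.+2 - n)%N); last by lia.
congr (_ * Posz (_ * #|` _|)); apply/fsetP => B; rewrite in_fsep !inE /= /fdim.
by rewrite (inj_eq (addIr _)).
Qed.

(** The factors d + 2 - j and j + 1 turn the weight into 1 / C(d + 2, j) and 1 / C(d + 2, j + 1), so
    each summand is up to sign a sum of two consecutive terms. *)
Lemma weight_telescope (d l : nat) (G : nat -> rat) : (l <= d.+1)%N ->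
  \sum_(0 <= j < l.+1) (-1) ^+ (l - j) *
      ((d.+2 - j)%N%:R * G j + j.+1%:R * G j.+1) * weight d.+1 j =
  G l.+1 / 'C(d.+2, l.+1)%:R + (-1) ^+ l * G 0.
Proof.
have H j : (j <= d.+1)%N -> ((d.+2 - j)%N%:R * G j + j.+1%:R * G j.+1) * weight d.+1 j =
    G j / 'C(d.+2, j)%:R + G j.+1 / 'C(d.+2, j.+1)%:R.
  move=> jd; have e1 : (d.+2 - j)%N%:R * weight d.+1 j = ('C(d.+2, j)%:R)^-1.
    by rewrite /weight (mul_bin_down d.+2) natrM invfM mulVKf // pnatr_eq0 subn_eq0 -ltnNge.
  have e2 : j.+1%:R * weight d.+1 j = ('C(d.+2, j.+1)%:R)^-1.
    by rewrite /weight (mul_bin_diag d.+2) natrM invfM mulVKf // pnatr_eq0.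
  by rewrite -e1 -e2; ring.
elim: l => [|l IHl] ld.
  by rewrite big_nat1 subnn expr0 mul1r H // bin0 divr1 mul1r addrC.
rewrite big_nat_recr //= subnn mul1r H //.
rewrite (_ : \sum_(0 <= j < l.+1) _ =
   - (G l.+1 / 'C(d.+2, l.+1)%:R + (-1) ^+ l * G 0)); first by rewrite exprS; ring.
rewrite -IHl ?(ltnW ld) // -sumrN; apply: eq_big_nat => j; rewrite ltnS => /andP[_ jl].
by rewrite subSn // exprS mulN1r !mulNr.
Qed.

(** * Averaging over the vertex links *)

Theorem proposition5p4 (F : fieldType) (d k : nat)
    (hk : (2 <= 2 * k)%N) (hd : (2 * k <= d)%N)
    (M : cplx) (hM : in_W k d M) (hM2 : two_neighbourly M) :
  [/\ (forall i : nat, (k + 1 <= i <= d - k - 1)%N -> mu F M i = 0),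
      (forall l : nat, (1 <= l <= k - 1)%N ->
         \sum_(1 <= i < l.+1) (-1) ^+ (l - i) * mu F M i
           <= (g_vec M l.+1)%:~R / 'C(d + 2, l + 1)%:R)
    & (forall l : nat, (k <= l <= d - k - 1)%N ->
         \sum_(1 <= i < l.+1) (-1) ^+ (l - i) * mu F M i
           = (g_vec M l.+1)%:~R / 'C(d + 2, l + 1)%:R)].
Proof.
have [_ cM _ dM stM] := hM; have k0 : (0 < k)%N by lia.
set n := #|` vertices M|.
have hlk x : x \in vertices M -> exists s, history F d k (lk M x) s.
  by move=> xM; exact: (stellated_history F k0 hd (stM x xM)).
have clk x : x \in vertices M -> is_complex (lk M x) by exact: is_complex_lk.
(* By 2-neighbourliness all links have n - 1 vertices, so the factor #V + 1 of the sigma-sums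
   cancels the 1/n in [mu]. *)
have nlk x : x \in vertices M -> #|` vertices (lk M x)|.+1 = n.
  by move=> xM; rewrite vertices_lk // -card_facet.
pose S l x := \sum_(0 <= i < l.+1) (-1) ^+ (l - i) * sigma F (lk M x) i.
pose T l x : rat := \sum_(0 <= j < l.+2)
  (-1) ^+ (l.+1 - j) * (gcount d.+1 (lk M x) j)%:~R * weight d.+1 j.
(* The sign (-1)^l comes from the Kronecker delta in [mu] at 1. *)
have muE l : \sum_(1 <= i < l.+2) (-1) ^+ (l.+1 - i) * mu F M i =
    (-1) ^+ l + n%:R^-1 * \sum_(x <- vertices M) S l x.
  rewrite big_add1 /=; under eq_bigr do rewrite mulrDr.
  rewrite big_split /=; congr (_ + _).
    by rewrite big_nat_recl //= subn1 mulr1 big1 ?addr0 // => i _; rewrite mulr0.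
  rewrite exchange_big /= mulr_sumr; apply: eq_bigr => i _.
  by rewrite subSS mulrCA mulr_sumr.
(* That sign cancels the boundary term of the telescoping sum, where the g-number of index 0 is
   1. *)
have TE l : (l.+1 < d - k)%N ->
    (-1) ^+ l + \sum_(x <- vertices M) T l x = (g_vec M l.+2)%:~R / 'C(d + 2, l.+1 + 1)%:R.
  move=> lt; rewrite addn2 addn1.
  have := @weight_telescope d l.+1 (fun j => (gcount d.+2 M j)%:~R).
  rewrite -(g_vecE (j := l.+2) dM) => [e|]; last by lia.
  apply: (addIr ((-1) ^+ l.+1)).
  have G0 : gcount d.+2 M 0 = 1 by rewrite /gcount big_nat1 subnn mul1r bin0 mul1n fcount0.
  move: e; rewrite G0 mulr1 => <-; last by lia.
  rewrite exprS addrAC mulN1r subrr add0r exchange_big /=.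
  apply: eq_big_nat => j; rewrite ltnS => /andP[_ jl].
  rewrite -mulr_suml -mulr_sumr; congr (_ * _ * _).
  rewrite -rmorph_sum sum_gcount_lk //; last by lia.
  by rewrite rmorphD !rmorphM.
have ST l x : x \in vertices M -> (k <= l.+1 < d - k)%N -> S l x = n%:R * T l x.
  by move=> xM kl; have [s hs] := hlk x xM; rewrite /S (sum_sigma_eq (clk x xM) hs kl) nlk.
have nT (l : nat) : n%:R^-1 * (\sum_(x <- vertices M) n%:R * T l x) = \sum_(x <- vertices M) T l x.
  rewrite mulr_sumr big_seq [RHS]big_seq; apply: eq_bigr => x xM.
  by rewrite mulKf // pnatr_eq0 -(nlk x xM).
split=> [[|i] /andP[ki it]|[//|l] /andP[_ lk1]|[|l] /andP[kl lt]].
- by lia.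
- rewrite /mu eqSS gtn_eqF ?add0r; last by lia.
  rewrite big1_seq ?mulr0 // => x /= xM; have [s hs] := hlk x xM.
  by apply: (sigma_eq0 k0 (clk x xM) hs); lia.
(* Here l + 1 < k <= d - k, so only the inequality for each link is available. *)
- rewrite muE -TE; last by lia.
  rewrite lerD2l -nT ler_wpM2l ?invr_ge0 // big_seq [leRHS]big_seq; apply: ler_sum => x xM.
  have [s hs] := hlk x xM; rewrite /S (le_trans (sum_sigma_le (clk x xM) hs _)) ?nlk //; lia.
- by lia.
- rewrite muE -TE; last by lia.
  congr (_ + _); rewrite -nT; congr (_ * _); rewrite big_seq [RHS]big_seq.
  by apply: eq_bigr => x xM; rewrite ST //; lia.
Qed.
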